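(* Let $K$ be the Cantor space and let $\Omega$ be an infinite compact metric space which admits the structure of a finite-dimensional connected finite CW-complex and satisfies the Lipschitz-minimal-property (LMP). Put $X=K\times\Omega$. Then for every Cantor minimal system $(K,\tilde\alpha)$ there exist $L>0$ and uncountably many continuous maps $c\in C(K,G_L(\Omega))$ such that $(X,\tilde\alpha\times c)$ is a minimal dynamical system.
   Context: A Cantor minimal system $(K,\tilde\alpha)$ is a minimal homeomorphism $\tilde\alpha$ of the Cantor space $K$. A homeomorphism of a compact metric space is minimal if all its orbits are dense, i.e. it has no nonempty proper invariant closed set. For a compact metric space $Z$, $\mathcal H(Z)$ is the group of homeomorphisms of $Z$ with the complete metric $d(f,g)=\sup_z d(f(z),g(z))+\sup_z d(f^{-1}(z),g^{-1}(z))$. For a continuous map $c:K\to\mathcal H(\Omega)$, $x\mapsto c_x$, the homeomorphism $\tilde\alpha\times c$ of $K\times\Omega$ is $(x,\omega)\mapsto(\tilde\alpha(x),c_x(\omega))$. A closed subset $M\subset\mathcal H(Z)$ acts minimally on $Z$ if for every nonempty open $O\subset Z$ there are finitely many $h_1,\dots,h_n\in M$ with $\bigcup_i h_i(O)=Z$. For $L>0$, $\mathcal G_L(Z)$ is the set of homeomorphisms $f$ in the identity path component of $\mathcal H(Z)$ that are $L$-Lipschitz, i.e. $d(f(z_1),f(z_2))\le L\,d(z_1,z_2)$ for all $z_1,z_2$. $Z$ satisfies the Lipschitz-minimal-property (LMP) if there are $L>0$ and a pathwise connected set $M\subset\mathcal G_L(Z)$ which acts minimally on $Z$. $G_L(\Omega)$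 is the closed subgroup of $\mathcal H(\Omega)$ generated by $\mathcal G_L(\Omega)$. *)

(* Defs.v *)
From HB Require Import structures.
From mathcomp Require Import all_boot all_order all_algebra.
From mathcomp Require Import all_classical all_reals all_analysis.

Set Implicit Arguments.
Unset Strict Implicit.
Unset Printing Implicit Defensive.

Import Order.TTheory GRing.Theory Num.Theory.
Import numFieldNormedType.Exports.

Local Open Scope classical_set_scope.
Local Open Scope ring_scope.

HB.mixin Record isCompactSpace T & Topological T := {
  compact_setT : compact [set: T]
}.

#[short(type="compactMetricType")]
HB.structure Definition CompactMetric (R : numDomainType) :=
  { T of Metric R T & isCompactSpace T }.

Record homeo (Z : topologicalType) := Homeo {
  homeo_fun :> Z -> Z;
  homeo_inv : Z -> Z;
  homeo_cts : continuous homeo_fun;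
  homeo_inv_cts : continuous homeo_inv;
  homeo_funK : cancel homeo_fun homeo_inv;
  homeo_invK : cancel homeo_inv homeo_fun }.

HB.instance Definition _ (Z : topologicalType) := gen_eqMixin (homeo Z).
HB.instance Definition _ (Z : topologicalType) := gen_choiceMixin (homeo Z).

Section homeo_group.
Context {Z : topologicalType}.
Implicit Types f g h : homeo Z.

Lemma homeo_eq f g : (forall z, f z = g z) -> f = g.
Proof.
move: f g => [f f' cf cf' fK fK'] [g g' cg cg' gK gK'] /= fg.
have efg : f = g by apply/funext.
subst g.
have efg' : f' = g' by apply/funext => z; rewrite -{1}(gK' z) fK.
subst g'.
by congr Homeo; exact: Prop_irrelevance.
Qed.

Definition homeo_id : homeo Z :=
  @Homeo Z id id (fun=> cvg_id) (fun=> cvg_id) (fun=> erefl) (fun=> erefl).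

Definition homeo_flip f : homeo Z :=
  Homeo (@homeo_inv_cts _ f) (@homeo_cts _ f)
        (@homeo_invK _ f) (@homeo_funK _ f).

Lemma homeo_comp_cts f g : continuous (f \o g).
Proof.
by move=> z; apply: continuous_comp; [exact: homeo_cts | exact: homeo_cts].
Qed.

Lemma homeo_comp_inv_cts f g : continuous (homeo_inv g \o homeo_inv f).
Proof.
by move=> z; apply: continuous_comp; exact: homeo_inv_cts.
Qed.

Definition homeo_comp f g : homeo Z :=
  Homeo (@homeo_comp_cts f g) (@homeo_comp_inv_cts f g)
        (can_comp (@homeo_funK _ f) (@homeo_funK _ g))
        (can_comp (@homeo_invK _ g) (@homeo_invK _ f)).

Lemma homeo_compA : associative homeo_comp.
Proof. by move=> f g h; apply: homeo_eq. Qed.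

Lemma homeo_comp1f : left_id homeo_id homeo_comp.
Proof. by move=> f; apply: homeo_eq. Qed.

Lemma homeo_compf1 : right_id homeo_id homeo_comp.
Proof. by move=> f; apply: homeo_eq. Qed.

Lemma homeo_compVf : left_inverse homeo_id homeo_flip homeo_comp.
Proof. by move=> f; apply: homeo_eq => z /=; rewrite homeo_funK. Qed.

Lemma homeo_compfV : right_inverse homeo_id homeo_flip homeo_comp.
Proof. by move=> f; apply: homeo_eq => z /=; rewrite homeo_invK. Qed.

HB.instance Definition _ := isGroup.Build (homeo Z)
  homeo_compA homeo_comp1f homeo_compf1 homeo_compVf homeo_compfV.

End homeo_group.

Section homeo_metric.
Context {R : realType} {Z : compactMetricType R}.
Implicit Types f g h : homeo Z.

Definition sup_mdist (f g : Z -> Z) : R :=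
  sup [set mdist (f z) (g z) | z in [set: Z]].

Definition homeo_dist f g : R :=
  sup_mdist f g + sup_mdist (homeo_inv f) (homeo_inv g).

Lemma near_mdist (z : Z) (e : R) : 0 < e -> \forall t \near z, mdist z t < e.
Proof.
by move=> e0; have := nbhsx_ballx z e e0; rewrite ballEmdist.
Qed.

Lemma mdist_bounded : exists B : R, forall x y : Z, mdist x y <= B.
Proof.
have [[z0 _]|/set0P/negP/negPn/eqP Z0] := pselect ([set: Z] !=set0); last first.
  by exists 0 => x; have : [set: Z] x by []; rewrite Z0.
have ct : {within [set: Z], continuous (fun z => mdist z0 z : R)}.
  apply: continuous_subspaceT => z; apply/cvgrPdist_lt => e e0.
  near=> t.
  have zt : mdist z t < e by near: t; exact: near_mdist.
  have tr1 := metric_triangle z0 z t; have tr2 := metric_triangle z0 t z.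
  rewrite ltr_norml; rewrite (metric_sym t z) in tr2.
  apply/andP; split.
    by rewrite ltrBrDl ltrBlDr (le_lt_trans tr1)// ltrD2l.
  by rewrite ltrBlDl (le_lt_trans tr2)// ltrD2l.
have /compact_bounded[M [_ HM]] := continuous_compact ct compact_setT.
exists ((M + 1) + (M + 1)) => x y.
have bd t : mdist z0 t <= M + 1.
  apply: le_trans (ler_norm _) _; apply: (HM (M + 1)); first by rewrite ltrDl.
  by exists t.
by rewrite (le_trans (metric_triangle x z0 y))// lerD// metric_sym.
Unshelve. all: by end_near. Qed.

Lemma sup_mdist_ub (f g : Z -> Z) z : mdist (f z) (g z) <= sup_mdist f g.
Proof.
have [B HB] := mdist_bounded.
apply: ub_le_sup; last by exists z.
by exists B => _ [t _ <-]; exact: HB.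
Qed.

Lemma sup_mdist_ge0 (f g : Z -> Z) : 0 <= sup_mdist f g.
Proof.
have [[z0 _]|/set0P/negP/negPn/eqP Z0] := pselect ([set: Z] !=set0).
  exact: le_trans (mdist_ge0 _ _) (sup_mdist_ub f g z0).
by rewrite /sup_mdist Z0 image_set0 sup0.
Qed.

Lemma sup_mdistxx (f : Z -> Z) : sup_mdist f f = 0.
Proof.
apply/eqP; rewrite eq_le sup_mdist_ge0 andbT.
have [[z0 _]|/set0P/negP/negPn/eqP Z0] := pselect ([set: Z] !=set0).
  apply: ge_sup; first by exists (mdist (f z0) (f z0)); exists z0.
  by move=> _ [t _ <-]; rewrite mdistxx.
by rewrite /sup_mdist Z0 image_set0 sup0.
Qed.

Lemma sup_mdist_sym (f g : Z -> Z) : sup_mdist f g = sup_mdist g f.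
Proof. by congr sup; apply: eq_imagel => z _; rewrite metric_sym. Qed.

Lemma sup_mdist_triangle (g f h : Z -> Z) :
  sup_mdist f h <= sup_mdist f g + sup_mdist g h.
Proof.
have [[z0 _]|/set0P/negP/negPn/eqP Z0] := pselect ([set: Z] !=set0).
  apply: ge_sup; first by exists (mdist (f z0) (h z0)); exists z0.
  move=> _ [t _ <-]; rewrite (le_trans (metric_triangle _ (g t) _))//.
  by rewrite lerD// sup_mdist_ub.
by rewrite /sup_mdist Z0 !image_set0 sup0 addr0.
Qed.

Lemma homeo_distxx f : homeo_dist f f = 0.
Proof. by rewrite /homeo_dist !sup_mdistxx addr0. Qed.

Lemma homeo_dist_eq0 f g : homeo_dist f g = 0 -> f = g.
Proof.
move/eqP; rewrite paddr_eq0 ?sup_mdist_ge0// => /andP[/eqP fg _].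
apply: homeo_eq => z; apply: (@mdist_positivity R).
by apply/eqP; rewrite eq_le mdist_ge0 andbT -fg sup_mdist_ub.
Qed.

Lemma homeo_dist_sym f g : homeo_dist f g = homeo_dist g f.
Proof. by rewrite /homeo_dist !(sup_mdist_sym f, sup_mdist_sym (homeo_inv f)). Qed.

Lemma homeo_dist_triangle g f h :
  homeo_dist f h <= homeo_dist f g + homeo_dist g h.
Proof. by rewrite /homeo_dist addrACA lerD// sup_mdist_triangle. Qed.

HB.instance Definition _ := isMetric.Build R (homeo Z)
  homeo_distxx homeo_dist_eq0 homeo_dist_sym homeo_dist_triangle.

End homeo_metric.

Section minimality.
Context {Z : topologicalType}.

Definition orbit_of (h : homeo Z) (z : Z) : set Z :=
  [set y | exists n, y = (h ^+ n)%g z \/ y = (h ^- n)%g z].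

Definition minimal_homeo (h : homeo Z) := forall z, dense (orbit_of h z).

End minimality.

Section skew_product.
Context {R : realType} {K : topologicalType} {Z : compactMetricType R}.
Variables (alpha : homeo K) (c : continuousType K (homeo Z)).

Definition skew_fun (p : K * Z) : K * Z := (alpha p.1, c p.1 p.2).

Definition skew_inv (p : K * Z) : K * Z :=
  (homeo_inv alpha p.1, homeo_inv (c (homeo_inv alpha p.1)) p.2).

Lemma near_homeo_dist (h : homeo Z) (e : R) :
  0 < e -> \forall t \near h, homeo_dist h t < e.
Proof.
by move=> e0; have := nbhsx_ballx h e e0; rewrite ballEmdist.
Qed.

Lemma eval_cts (F : homeo Z -> Z -> Z) (u : K -> homeo Z) :
  (forall h, continuous (F h)) ->
  (forall f g z, mdist (F f z) (F g z) <= homeo_dist f g) ->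
  continuous u -> continuous (fun p : K * Z => F (u p.1) p.2).
Proof.
move=> cF dF cu [x0 z0] /=.
apply/metricType_numDomainType.cvgrPdist_lt => e e0.
have e20 : 0 < e / 2 by rewrite divr_gt0.
have N1 : \forall x \near x0, homeo_dist (u x0) (u x) < e / 2.
  exact: cu (near_homeo_dist (u x0) e20).
have N2 : \forall z \near z0, mdist (F (u x0) z0) (F (u x0) z) < e / 2.
  exact: cF (near_mdist (F (u x0) z0) e20).
exists ([set x | homeo_dist (u x0) (u x) < e / 2],
        [set z | mdist (F (u x0) z0) (F (u x0) z) < e / 2]) => //.
move=> [x z] [/= Hx Hz].
rewrite (le_lt_trans (metric_triangle _ (F (u x0) z) _))// (splitr e).
by rewrite ltrD// (le_lt_trans (dF _ _ _)).
Qed.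

Lemma skew_fun_cts : continuous skew_fun.
Proof.
move=> p; apply: cvg_pair.
  by apply: (continuous_comp (f := fst)); [exact: cvg_fst | exact: homeo_cts].
apply: (@eval_cts (fun h => homeo_fun h) c).
- by move=> h; exact: homeo_cts.
- move=> f g z; rewrite (le_trans (sup_mdist_ub f g z))//.
  by rewrite lerDl sup_mdist_ge0.
- exact: cts_fun.
Qed.

Lemma skew_inv_cts : continuous skew_inv.
Proof.
move=> p; apply: cvg_pair.
  by apply: (continuous_comp (f := fst)); [exact: cvg_fst | exact: homeo_inv_cts].
apply: (@eval_cts (fun h => homeo_inv h) (c \o homeo_inv alpha)).
- by move=> h; exact: homeo_inv_cts.
- move=> f g z; rewrite (le_trans (sup_mdist_ub (homeo_inv f) (homeo_inv g) z))//.
  by rewrite lerDr sup_mdist_ge0.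
- by move=> x; apply: continuous_comp; [exact: homeo_inv_cts | exact: cts_fun].
Qed.

Lemma skew_funK : cancel skew_fun skew_inv.
Proof. by move=> [x z]; rewrite /skew_inv/= !homeo_funK. Qed.

Lemma skew_invK : cancel skew_inv skew_fun.
Proof. by move=> [x z]; rewrite /skew_fun/= !homeo_invK. Qed.

Definition skew_product : homeo (K * Z)%type :=
  Homeo skew_fun_cts skew_inv_cts skew_funK skew_invK.

End skew_product.

Definition joined_in (R : realType) (T : topologicalType) (M : set T) (x y : T) :=
  exists gamma : R -> T,
    [/\ {within `[0, 1], continuous gamma}, gamma 0 = x, gamma 1 = y &
        forall t, t \in `[0, 1] -> M (gamma t)].

Definition pathwise_connected (R : realType) (T : topologicalType) (M : set T) :=
  forall x y, M x -> M y -> joined_in R M x y.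

Section lipschitz_minimal.
Context {R : realType} (Z : compactMetricType R).

Definition acts_minimally (M : set (homeo Z)) :=
  closed M /\
  forall O : set Z, open O -> O !=set0 ->
    exists2 hs : seq (homeo Z), [set` hs] `<=` M &
      \bigcup_(h in [set` hs]) (h @` O) = [set: Z].

Definition lip_homeo (L : R) : set (homeo Z) :=
  [set f | joined_in R setT (1%g : homeo Z) f /\
           forall z1 z2, mdist (f z1) (f z2) <= L * mdist z1 z2].

Definition lipschitz_minimal_property :=
  exists L : R, 0 < L /\
    exists M : set (homeo Z),
      [/\ M `<=` lip_homeo L, pathwise_connected R M & acts_minimally M].

Definition closed_subgroup (G : set (homeo Z)) :=
  [/\ closed G, G 1%g & forall f g, G f -> G g -> G (f * g^-1)%g].

Definition lip_group (L : R) : set (homeo Z) :=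
  smallest closed_subgroup (lip_homeo L).

End lipschitz_minimal.

Section cw_complex.
Context (R : realType).

(* The library's norm on ['rV[R]_n] is the sup norm, so the Euclidean discs are
   spelled out; for [n = 0] both discs are a point and the sphere is empty. *)
Definition normsq n (v : 'rV[R]_n) : R := \sum_(i < n) v 0 i ^+ 2.
Definition disc n : set 'rV[R]_n := [set v | normsq v <= 1].
Definition open_disc n : set 'rV[R]_n := [set v | normsq v < 1].
Definition sphere n : set 'rV[R]_n := [set v | normsq v = 1].

(* Whitehead's definition, for finitely many cells: closure-finiteness and the
   weak topology are then automatic, as is finite-dimensionality. *)
Record finite_CW (Z : topologicalType) := FiniteCW {
  cw_hausdorff : hausdorff_space Z;
  cw_cell : finType;
  cw_dim : cw_cell -> nat;
  cw_char : forall e : cw_cell, 'rV[R]_(cw_dim e) -> Z;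
  cw_open_cell := fun e : cw_cell => cw_char (e := e) @` @open_disc (cw_dim e);
  cw_char_cts : forall e, {within @disc (cw_dim e), continuous (@cw_char e)};
  cw_char_inj : forall e, {in @open_disc (cw_dim e) &, injective (@cw_char e)};
  cw_char_open : forall e (U : set 'rV[R]_(cw_dim e)), open U ->
    exists2 V : set Z, open V &
      @cw_char e @` (U `&` @open_disc (cw_dim e)) = V `&` cw_open_cell e;
  cw_disjoint : trivIset setT cw_open_cell;
  cw_cover : \bigcup_e cw_open_cell e = [set: Z];
  cw_boundary : forall e, @cw_char e @` @sphere (cw_dim e) `<=`
    \bigcup_(e' in [set e' | (cw_dim e' < cw_dim e)%N]) cw_open_cell e' }.

End cw_complex.

(* Main.v *)
Require Import Defs.
From mathcomp Require Import all_boot all_order all_algebra.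
From mathcomp Require Import all_classical all_reals all_analysis.
From mathcomp Require Import lra zify.

(** The minimal cocycles are found, by the Baire category method of Glasner and
    Weiss, among uniform limits of coboundaries.  A coboundary is a map
    [x |-> g(alpha x)^-1 * g(x)]; here [g] is locally constant on the Cantor
    space and takes its values in the closed group generated by the Lipschitz
    homeomorphisms.  The skew product over a coboundary is conjugate to
    [alpha * id], hence far from minimal, but any prescribed nonempty open set
    [V * O] can be made to meet every orbit by a uniformly small change of the
    coboundary ([coboundary_perturbation]).

    To see this, let [M] be the path connected set that acts minimally, and
    choose [h_1, ..., h_n] in [M] such that the sets [h_i (g O)] cover the
    fibre, where [g] is constant on a clopen part of [V].  Replace [g] by
    [h * g], where [h] has its values in [M] and equals each [h_i] on some
    nonempty open part of [V].  As [alpha] is minimal, every base orbit visits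
    all these parts, and the covering property then moves every fibre point
    into [O] at one of the visits.  The new coboundary is close to the old one
    as soon as [h(alpha x)] is close to [h(x)] for all [x].  This is where path
    connectedness enters: a finite chain with small steps runs through all the
    [h_i], waiting at each of them until the orbit of a base point is in [V]
    ([walk]), and it is spread over the levels of a tower above a small clopen
    set ([tower]).

    The property just obtained survives small uniform perturbations of the
    cocycle, because it concerns boundedly many iterates
    ([iter_skew_stable]).  So does the property of differing from a given
    cocycle with minimal skew product, and coboundaries have it for free since
    they are never minimal ([coboundary_not_minimal]).  A Baire type
    construction ([generic_cocycle]) gives a limit cocycle with countably many
    such properties.  It is minimal once the sets [V * O] form a base, and it
    avoids any countable list of minimal cocycles; hence these are
    uncountable. *)

Set Implicit Arguments.
Unset Strict Implicit.
Unset Printing Implicit Defensive.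

Import Order.TTheory GRing.Theory Num.Theory.
Import numFieldNormedType.Exports.

Local Open Scope classical_set_scope.
Local Open Scope ring_scope.

(** * Compact metric spaces and their homeomorphisms *)

Lemma near_all_seq {T : Type} {I : eqType} (F : set_system T) {FF : Filter F}
    (P : I -> T -> Prop) (s : seq I) :
  (forall i, i \in s -> \forall t \near F, P i t) ->
  \forall t \near F, forall i, i \in s -> P i t.
Proof.
elim: s => [|a s IH] Ps; first by apply: nearW.
have Pa := Ps a (mem_head _ _).
have {}IH : \forall t \near F, forall i, i \in s -> P i t.
  by apply: IH => i si; apply: Ps; rewrite inE si orbT.
apply: filterS2 Pa IH => t Pat Pst i.
by rewrite inE => /orP[/eqP ->|/Pst].
Qed.

(** Near covering, applied to the filter of finite sequences ordered by
    inclusion. *)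
Lemma compact_subcover {T : topologicalType} {I : eqType} (f : I -> set T) :
  compact [set: T] -> (forall x : T, exists i, nbhs x (f i)) ->
  exists s : seq I, forall x, exists2 i, i \in s & f i x.
Proof.
move=> /compact_near_coveringP cov xf.
pose above (s0 : seq I) : set (seq I) := [set s | {subset s0 <= s}].
have FF : ProperFilter (filter_from setT above).
  apply: filter_from_proper; last by move=> s _; exists s.
  apply: filter_from_filter; first by exists [::].
  move=> s t _ _; exists (s ++ t) => // w st.
  by split=> i si; apply: st; rewrite mem_cat si ?orbT.
have : \forall s \near filter_from setT above,
    [set: T] `<=` [set x | exists2 i, i \in s & f i x].
  apply: (cov _ _ (fun s x => exists2 i, i \in s & f i x)) => x _; have [i xi] := xf x.
  exists (f i, above [:: i]) => /=.
    by split => //; exists [:: i].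
  by move=> [y s] [/= yi si]; exists i => //; apply: si; rewrite mem_head.
by move=> /filter_ex[s sP]; exists s => x; exact: sP.
Qed.

Section compact_metric.
Context {R : realType} {Z : compactMetricType R}.
Implicit Types (f g : Z -> Z) (h k : homeo Z).

Lemma compact_unif_cont f (e : R) : continuous f -> 0 < e ->
  \forall d \near 0^'+, forall z w, mdist z w < d -> mdist (f z) (f w) < e.
Proof.
move=> cf e0; have e20 : 0 < e / 2 by rewrite divr_gt0.
have /compact_near_coveringP cov := @compact_setT R Z.
pose P (d : R) z := forall w, mdist z w < d -> mdist (f z) (f w) < e.
have : \forall d \near 0^'+, [set: Z] `<=` P d.
  apply: cov => z _.
  have /nbhs_ballP[r /= r0] : \forall w \near z, mdist (f z) (f w) < e / 2.
    exact: cf (near_mdist (f z) e20).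
  rewrite ballEmdist => fr.
  have r20 : 0 < r / 2 by rewrite divr_gt0.
  exists ([set w | mdist z w < r / 2], [set d | d < r / 2]).
    by split; [exact: near_mdist | exact: nbhs_right_lt].
  move=> [x d] [/= zx dr] w xw.
  have fx : mdist (f z) (f x) < e / 2 by apply: fr => /=; lra.
  have fw : mdist (f z) (f w) < e / 2.
    by apply: fr => /=; have := metric_triangle z x w; lra.
  have := metric_triangle (f x) (f z) (f w).
  by rewrite (metric_sym (f x) (f z)); lra.
by apply: filterS => d dP z w; exact: dP.
Qed.

Lemma sup_mdist_le f g (e : R) : 0 <= e ->
  (forall z, mdist (f z) (g z) <= e) -> sup_mdist f g <= e.
Proof.
move=> e0 fge; have [[z0 _]|/set0P/negP/negPn/eqP Z0] := pselect ([set: Z] !=set0).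
  by apply: ge_sup; [exists (mdist (f z0) (g z0)), z0 | move=> _ [z _ <-]].
by rewrite /sup_mdist Z0 image_set0 sup0.
Qed.

Lemma homeo_dist_fun h k z : mdist (h z) (k z) <= homeo_dist h k.
Proof. by rewrite (le_trans (sup_mdist_ub h k z))// lerDl sup_mdist_ge0. Qed.

Lemma homeo_dist_inv h k z :
  mdist (homeo_inv h z) (homeo_inv k z) <= homeo_dist h k.
Proof.
rewrite (le_trans (sup_mdist_ub (homeo_inv h) (homeo_inv k) z))//.
by rewrite lerDr sup_mdist_ge0.
Qed.

Lemma homeo_dist_ge0 h k : 0 <= homeo_dist h k.
Proof. by rewrite addr_ge0 ?sup_mdist_ge0. Qed.

Lemma homeo_dist_le h k (e : R) : 0 <= e ->
  (forall z, mdist (h z) (k z) <= e) ->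
  (forall z, mdist (homeo_inv h z) (homeo_inv k z) <= e) ->
  homeo_dist h k <= e + e.
Proof. by move=> e0 hk hki; rewrite lerD// sup_mdist_le. Qed.

(** Substituting [z = k^-1 w] turns the displacement of [h^-1 * k] into the
    distance between the inverses of [h] and [k].  So small steps in the group
    have small quotients without any equicontinuity. *)
Lemma homeo_dist_divl h k :
  homeo_dist (h^-1 * k)%g 1%g <= homeo_dist h k + homeo_dist h k.
Proof.
apply: homeo_dist_le; first exact: homeo_dist_ge0.
  move=> z; have := homeo_dist_inv h k (k z).
  by rewrite homeo_funK.
move=> z; have := homeo_dist_inv h k (h z).
by rewrite homeo_funK metric_sym.
Qed.

(** Uniform continuity of the outer factors; it is uniform in [a] and [b]
    because they range over a finite list, which is why [g] is taken with
    finite range. *)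
Lemma homeo_dist_insert (s : seq (homeo Z)) (e : R) : 0 < e ->
  \forall d \near 0^'+, forall a b k, a \in s -> b \in s ->
    homeo_dist k 1%g < d -> homeo_dist (a * k * b)%g (a * b)%g < e.
Proof.
move=> e0; have e30 : 0 < e / 3 by rewrite divr_gt0.
have U : \forall d \near 0^'+, forall a, a \in s -> forall z w,
    mdist z w < d -> mdist (a z) (a w) < e / 3.
  by apply: near_all_seq => a _; apply: compact_unif_cont => //; exact: homeo_cts.
have V : \forall d \near 0^'+, forall a, a \in s -> forall z w,
    mdist z w < d -> mdist (homeo_inv a z) (homeo_inv a w) < e / 3.
  by apply: near_all_seq => a _; apply: compact_unif_cont => //; exact: homeo_inv_cts.
apply: filterS2 U V => d U V a b k sa sb kd.
suff : homeo_dist (a * k * b)%g (a * b)%g <= e / 3 + e / 3 by lra.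
apply: homeo_dist_le; first exact: ltW.
  move=> z; apply: ltW; apply: (U a sa (k (b z)) (b z)).
  by apply: le_lt_trans kd; exact: (homeo_dist_fun k 1%g).
move=> z; apply: ltW.
apply: (V b sb (homeo_inv k (homeo_inv a z)) (homeo_inv a z)).
by apply: le_lt_trans kd; exact: (homeo_dist_inv k 1%g).
Qed.

(** Pointwise limits exist by compactness and are continuous by uniformity.  The
    limits of [u n] and of the inverses are inverse to each other, which is
    why the distance between homeomorphisms includes their inverses. *)
Lemma homeo_complete (u : nat -> homeo Z) (e : nat -> R) :
  (forall n m, (n <= m)%N -> homeo_dist (u n) (u m) <= e n) ->
  (forall r, 0 < r -> exists n, e n < r) ->
  exists f : homeo Z, forall n, homeo_dist (u n) f <= e n + e n.
Proof.
move=> ue e_small.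
have e_ge0 n : 0 <= e n by apply: le_trans (ue n n (leqnn n)); exact: homeo_dist_ge0.
have limit (v : nat -> Z -> Z) : (forall n, continuous (v n)) ->
    (forall n m z, (n <= m)%N -> mdist (v n z) (v m z) <= e n) ->
    exists2 F : Z -> Z, continuous F & forall n z, mdist (v n z) (F z) <= e n.
  move=> cv ve.
  have /choice[F vF] z : exists l, forall n, mdist (v n z) l <= e n.
    have [l [_ cl]] := @compact_setT R Z ((fun n => v n z) @ \oo) _ filterT.
    exists l => n; apply/ler_addgt0Pr => r r0.
    have : ((fun m => v m z) @ \oo) [set w | mdist (v n z) w <= e n].
      by exists n => // m /= nm; exact: ve.
    move=> /cl /(_ (near_mdist l r0))[w [/= vw lw]].
    have := metric_triangle (v n z) w l.
    by rewrite (metric_sym w l); lra.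
  exists F => // z.
  apply/metricType_numDomainType.cvgrPdist_lt => r r0.
  have r30 : 0 < r / 3 by rewrite divr_gt0.
  have [n en] := e_small _ r30.
  have : \forall t \near z, mdist (v n z) (v n t) < r / 3.
    exact: cv (near_mdist _ r30).
  apply: filterS => t vt.
  have := metric_triangle (F z) (v n z) (F t).
  have := metric_triangle (v n z) (v n t) (F t).
  have := vF t n; have := vF z n; rewrite (metric_sym (v n z) (F z)).
  by lra.
have [F cF uF] : exists2 F : Z -> Z, continuous F &
    forall n z, mdist (u n z) (F z) <= e n.
  apply: (limit (fun n => u n)) => [n|n m z nm]; first exact: homeo_cts.
  by apply: le_trans (ue _ _ nm); exact: homeo_dist_fun.
have [G cG uG] : exists2 G : Z -> Z, continuous G &
    forall n z, mdist (homeo_inv (u n) z) (G z) <= e n.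
  apply: (limit (fun n => homeo_inv (u n))) => [n|n m z nm].
    exact: homeo_inv_cts.
  by apply: le_trans (ue _ _ nm); exact: homeo_dist_inv.
(* [P (Q z)] is compared with [P (q n z)], as [p n] sends [q n z] back to [z] *)
have canc (p q : nat -> Z -> Z) (P Q : Z -> Z) : continuous P ->
    (forall n, cancel (q n) (p n)) ->
    (forall n z, mdist (p n z) (P z) <= e n) ->
    (forall n z, mdist (q n z) (Q z) <= e n) -> cancel Q P.
  move=> cP pq pP qQ z; apply: (@mdist_positivity R).
  apply/eqP; rewrite eq_le mdist_ge0 andbT; apply/ler_addgt0Pr => r r0.
  have r20 : 0 < r / 2 by rewrite divr_gt0.
  have /nbhs_ballP[d /= d0] : \forall w \near Q z, mdist (P (Q z)) (P w) < r / 2.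
    exact: cP (near_mdist _ r20).
  rewrite ballEmdist => Pd.
  have md0 : 0 < Num.min d (r / 2) by rewrite lt_min d0.
  have [n] := e_small _ md0; rewrite lt_min => /andP[nd nr].
  have := Pd (q n z); rewrite /= metric_sym => Pq.
  have := le_lt_trans (qQ n z) nd => /Pq{}Pq.
  have := metric_triangle (P (Q z)) (P (q n z)) z.
  by have := pP n (q n z); rewrite pq (metric_sym z); lra.
have FK : cancel F G.
  by apply: (canc (fun n => homeo_inv (u n)) u) => // n; exact: homeo_funK.
have GK : cancel G F.
  by apply: (canc u (fun n => homeo_inv (u n))) => // n; exact: homeo_invK.
by exists (Homeo cF cG FK GK) => n; exact: homeo_dist_le.
Qed.

Lemma closed_homeo_dist (A : set (homeo Z)) h : closed A ->
  (forall r, 0 < r -> exists2 a, A a & homeo_dist h a < r) -> A h.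
Proof.
move=> cA hA; apply: cA => B /nbhs_ballP[r /= r0]; rewrite ballEmdist => rB.
by have [a Aa ha] := hA r r0; exists a; split => //; exact: rB.
Qed.

Lemma finite_net (r : R) : 0 < r ->
  exists s : seq Z, forall z, exists2 w, w \in s & mdist w z < r.
Proof.
move=> r0; apply: (compact_subcover (f := fun w => [set z | mdist w z < r])).
  exact: compact_setT.
by move=> z; exists z; exact: near_mdist.
Qed.

End compact_metric.

(** * Orbits of minimal homeomorphisms *)

Section minimal_dynamics.
Context {K : topologicalType}.
Implicit Types (alpha : homeo K) (x y : K) (n : nat).

Lemma iter_homeo_cts alpha n : continuous (iter n alpha).
Proof.
elim: n => [|n IH] x; first exact: cvg_id.
by apply: continuous_comp; [exact: IH | exact: homeo_cts].
Qed.

Lemma homeo_expgE alpha n x : (alpha ^+ n)%g x = iter n alpha x.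
Proof. by elim: n => [|n IH]//; rewrite expgS /= -IH. Qed.

Lemma homeo_expKg alpha n : cancel (iter n alpha) (homeo_inv (alpha ^+ n)%g).
Proof. by move=> x; rewrite -homeo_expgE homeo_funK. Qed.

(** Minimality gives visits in forward or backward time, boundedly many by
    compactness; shifting the time origin by the bound makes them forward. *)
Lemma minimal_hitting alpha (A : set K) : compact [set: K] ->
  minimal_homeo alpha -> open A -> A !=set0 ->
  \forall N \near \oo, forall y, exists2 n, (n <= N)%N & A (iter n alpha y).
Proof.
move=> cK malpha oA A0.
pose f (i : nat * bool) :=
  [set x | A ((if i.2 then alpha ^+ i.1 else alpha ^- i.1)%g x)].
have [|s sP] := compact_subcover (f := f) cK.
  move=> y; have [z [Az [n [yz|yz]]]] := malpha y A A0 oA; rewrite yz in Az.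
    exists (n, true); apply: (homeo_cts (h := (alpha ^+ n)%g)).
    exact: open_nbhs_nbhs.
  exists (n, false); apply: (homeo_cts (h := (alpha ^- n)%g)).
  exact: open_nbhs_nbhs.
pose M := \max_(i <- s) i.1.
have Ms i : i \in s -> (i.1 <= M)%N by move=> si; exact: leq_bigmax_seq.
exists (M + M)%N => // N /= MN y.
have [[n b] /Ms/= nM] := sP (iter M alpha y).
rewrite /f/=; case: b => /=.
  by rewrite homeo_expgE -iterD => An; exists (n + M)%N => //; lia.
rewrite -[M in iter M _](subnKC nM) iterD homeo_expKg => An.
by exists (M - n)%N => //; lia.
Qed.

Lemma minimal_recurrent alpha (A : set K) x : compact [set: K] ->
  minimal_homeo alpha -> open A -> A !=set0 ->
  forall l, exists2 j, (l <= j)%N & A (iter j alpha x).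
Proof.
move=> cK malpha oA A0 l.
have /filter_ex[N /(_ (iter l alpha x))[n _ An]] := minimal_hitting cK malpha oA A0.
by exists (n + l)%N; [exact: leq_addl | rewrite iterD].
Qed.

(** A periodic orbit would be finite, closed and dense. *)
Lemma minimal_aperiodic alpha x j : hausdorff_space K ->
  infinite_set [set: K] -> minimal_homeo alpha -> (0 < j)%N ->
  iter j alpha x <> x.
Proof.
move=> hK iK malpha j0 xj; apply: iK.
have xjm m : iter (m * j) alpha x = x.
  by elim: m => // m IH; rewrite mulSn iterD IH.
have per n : exists2 i, (i < j)%N & iter n alpha x = iter i alpha x.
  exists (n %% j)%N; first by rewrite ltn_pmod.
  by rewrite [in LHS](divn_eq n j) addnC iterD xjm.
pose F := (fun i => iter i alpha x) @` `I_j.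
have finF : finite_set F by exact/finite_image/finite_II.
have cF : closed F.
  exact: (compact_closed hK (finite_compact finF)).
have orbF : orbit_of alpha x `<=` F.
  move=> _ [n [->|->]].
    by rewrite homeo_expgE; have [i ij ->] := per n; exists i.
  rewrite /=; have -> : homeo_inv (alpha ^+ n)%g x = iter (n * j - n) alpha x.
    have back : iter n alpha (iter (n * j - n) alpha x) = x.
      by rewrite -iterD subnKC ?xjm// leq_pmulr.
    by rewrite -[x in LHS]back homeo_expKg.
  by have [i ij ->] := per (n * j - n)%N; exists i.
apply: sub_finite_set finF => y _; apply: contrapT => Fy.
have [z [Fz /orbF]] := malpha x (~` F) (ex_intro _ y Fy) (closed_openC cF).
exact: Fz.
Qed.

End minimal_dynamics.

(** * Chains of small steps in a path connected set *)

Section chains.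
Context {R : realType} {T : metricType R}.
Implicit Types (C M : set T) (e : R).

Definition near_step e : rel T := fun a b => mdist a b < e.

(** The points that a chain of small steps reaches form a relatively clopen
    subset. *)
Lemma connected_chain C e x y : 0 < e -> connected C -> C x -> C y ->
  exists s : seq T, [/\ forall t, t \in s -> C t, path (near_step e) x s &
                        last x s = y].
Proof.
move=> e0 cC Cx Cy.
pose reach := [set z | exists s : seq T,
  [/\ forall t, t \in s -> C t, path (near_step e) x s & last x s = z]].
suff CE : C `&` reach = C by have [] : (C `&` reach) y by rewrite CE.
have reach_step z t : reach z -> C t -> mdist z t < e -> reach t.
  move=> [s [sC ps lz]] Ct zt; exists (rcons s t); split.
  - by move=> u; rewrite mem_rcons inE => /orP[/eqP ->|/sC].
  - by rewrite rcons_path ps lz.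
  - by rewrite last_rcons.
have reachx : reach x by exists [::].
pose near_set (A : set T) := \bigcup_(z in A) (ball z e)°.
have near_open A : open (near_set A).
  by apply: bigcup_open => z _; exact: open_interior.
have near_self (A : set T) z : A z -> near_set A z.
  by move=> Az; exists z => //; exact: nbhsx_ballx.
apply: cC; first by exists x.
- exists (near_set (C `&` reach)) => //.
  apply/seteqP; split=> z [Cz zr]; split => //; first exact: near_self.
  have [t [Ct tr] /interior_subset] := zr.
  by rewrite ballEmdist => tz; exact: reach_step tr Cz tz.
- exists (~` near_set (C `&` ~` reach)).
    exact: open_closedC.
  apply/seteqP; split=> z [Cz zr]; split => //.
    move=> [t [Ct tr] /interior_subset]; rewrite ballEmdist => tz.
    by apply: tr; apply: reach_step zr Ct _; rewrite metric_sym.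
  by apply: contrapT => nr; apply: zr; exact: near_self.
Qed.

Lemma joined_chain M e x y : 0 < e -> joined_in R M x y ->
  exists s : seq T, [/\ forall t, t \in s -> M t, path (near_step e) x s &
                        last x s = y].
Proof.
move=> e0 [gamma [cgamma g0 g1 gM]].
have cI : connected (gamma @` `[0, 1]).
  by apply: connected_continuous_connected => //; exact: segment_connected.
have [| |s [sC sp sl]] := connected_chain (x := x) (y := y) e0 cI.
- by exists 0 => //=; rewrite in_itv/= lexx ler01.
- by exists 1 => //=; rewrite in_itv/= lexx ler01.
exists s; split => // t /sC[r /= r01 <-]; exact: gM.
Qed.

Lemma near_step_nseq e a n : 0 < e -> path (near_step e) a (nseq n a).
Proof. by move=> e0; elim: n => //= n ->; rewrite /near_step mdistxx e0. Qed.

(** The walk handles the targets one after the other: it goes from [m0] to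
    [h], waits there until the next visiting time, and comes back to [m0]. *)
Lemma walk M m0 (visit : nat -> Prop) e (hs : seq T) : 0 < e ->
  pathwise_connected R M -> M m0 ->
  (forall l, exists2 j, (l <= j)%N & visit j) ->
  (forall h, h \in hs -> M h) ->
  exists ks : seq T,
    [/\ forall k, k \in ks -> M k, path (near_step e) m0 (rcons ks m0) &
        forall h, h \in hs -> exists j,
          [/\ (j < size ks)%N, nth m0 ks j = h & visit j]].
Proof.
move=> e0 pM Mm0 vis.
elim: hs => [|h hs IH] hsM.
  by exists [::]; split => //=; rewrite /near_step mdistxx e0.
have [|ks [ksM ksp ksv]] := IH; first by move=> k khs; apply: hsM; rewrite inE khs orbT.
have Mh : M h by apply: hsM; rewrite mem_head.
have [s1 [s1M s1p s1l]] := joined_chain e0 (pM _ _ Mm0 Mh).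
have [s2 [s2M s2p s2l]] := joined_chain e0 (pM _ _ Mh Mm0).
set l := (size ks + (size s1).+1)%N.
have [j lj vj] := vis l.
pose wait := nseq (j.+1 - l) h.
exists (ks ++ (m0 :: s1) ++ wait ++ s2); split.
- move=> k; rewrite !(mem_cat, inE) => /or4P[/ksM//|/orP[/eqP->//|/s1M//]| |/s2M//].
  by rewrite mem_nseq => /andP[_ /eqP ->].
- rewrite rcons_path; apply/andP; split.
    rewrite -cat_rcons cat_path ksp last_rcons cat_path s1p s1l cat_path.
    rewrite near_step_nseq//=.
    by have -> : last h wait = h by rewrite /wait; elim: (_ - _)%N.
  rewrite !last_cat/= s1l.
  have -> : last h wait = h by rewrite /wait; elim: (_ - _)%N.
  by rewrite s2l /near_step mdistxx.
- move=> k; rewrite inE => /orP[/eqP ->|/ksv[i [ik <- vi]]]; last first.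
    exists i; split => //; first by rewrite size_cat ltn_addr.
    by rewrite nth_cat ik.
  exists j; split => //.
    by rewrite !size_cat/= /wait size_nseq; lia.
  rewrite catA nth_cat size_cat/= -/l ltnNge lj/= nth_cat size_nseq.
  by rewrite ltn_sub2r ?nth_nseq ?ltn_sub2r//; lia.
Qed.

End chains.

(** * Locally constant maps and coboundaries *)

Section locally_constant.
Context {K : topologicalType}.

Definition locally_constant {T : Type} (g : K -> T) :=
  forall x, \forall y \near x, g y = g x.

Lemma locally_constant_clopen {T : Type} (g : K -> T) t :
  locally_constant g -> clopen [set x | g x = t].
Proof.
move=> lg; split.
  by rewrite openE => x /= <-; exact: lg.
by move=> x /(_ _ (lg x))[y [/= <- ->]].
Qed.

Lemma locally_constant_range {T : eqType} (g : K -> T) : compact [set: K] ->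
  locally_constant g -> exists s : seq T, forall x, g x \in s.
Proof.
move=> cK lg.
have [x|s sP] := compact_subcover (f := fun t => [set x | g x = t]) cK.
  by exists (g x); exact: lg.
by exists s => x; have [t st /= ->] := sP x.
Qed.

Lemma locally_constant_comp {T : Type} (g : K -> T) (f : K -> K) :
  continuous f -> locally_constant g -> locally_constant (g \o f).
Proof. by move=> cf lg x; exact: cf (lg (f x)). Qed.

Lemma locally_constant2 {T1 T2 T : Type} (op : T1 -> T2 -> T) g1 g2 :
  locally_constant g1 -> locally_constant g2 ->
  locally_constant (fun x => op (g1 x) (g2 x)).
Proof. by move=> l1 l2 x; apply: filterS2 (l1 x) (l2 x) => y -> ->. Qed.

End locally_constant.

Section tower.
Context {K : topologicalType} {T : eqType} (alpha : homeo K) (m0 : T).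
Variable W : set K.

(** [tower ks x] is the entry of [ks] at the time elapsed since the orbit of
    [x] was last in [W], and [m0] if that was too long ago.  Reading the past
    makes it locally constant without partitioning the space into towers. *)
Fixpoint tower (ks : seq T) (x : K) : T :=
  if ks is k :: ks' then
    if `[< W x >] then k else tower ks' (homeo_inv alpha x)
  else m0.

Lemma tower_locally_constant ks : clopen W -> locally_constant (tower ks).
Proof.
move=> [oW cW]; elim: ks => [|k ks IH] x; first exact: nearW.
rewrite /=; have IHx := locally_constant_comp (@homeo_inv_cts _ alpha) IH x.
have [Wx|Wx] := pselect (W x).
  apply: filterS (open_nbhs_nbhs (conj oW Wx)) => y Wy.
  by rewrite !asboolT.
apply: filterS2 (open_nbhs_nbhs (conj (closed_openC cW) Wx)) IHx => y Wy /= ->.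
by rewrite !asboolF.
Qed.

Lemma tower_in (M : set T) ks x : M m0 -> (forall k, k \in ks -> M k) ->
  M (tower ks x).
Proof.
move=> Mm0; elim: ks x => //= k ks IH x ksM.
case: ifP => _; first by apply: ksM; rewrite mem_head.
by apply: IH => t tks; apply: ksM; rewrite inE tks orbT.
Qed.

Lemma tower_level ks x j : W x ->
  (forall i, (0 < i)%N -> (i <= j)%N -> ~ W (iter i alpha x)) ->
  tower ks (iter j alpha x) = nth m0 ks j.
Proof.
move=> Wx; elim: j ks => [|j IH] [|k ks] nW //=; first by rewrite asboolT.
rewrite asboolF ?homeo_funK; last exact: (nW j.+1).
by apply: IH => i i0 ij; apply: nW => //; exact: leqW.
Qed.

Lemma tower_off ks x :
  (forall i, (i < size ks)%N -> ~ W (iter i (homeo_inv alpha) x)) ->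
  tower ks x = m0.
Proof.
elim: ks x => //= k ks IH x nW; rewrite asboolF; last exact: (nW 0%N).
by apply: IH => i ik; rewrite -iterSr; exact: (nW i.+1).
Qed.

Lemma iter_inv_homeo n x : iter n alpha (iter n (homeo_inv alpha) x) = x.
Proof. by elim: n x => // n IH x; rewrite iterS iterSr IH homeo_invK. Qed.

(** Along an orbit the tower function either moves one step in the list or
    restarts at its head.  The latter happens only after the list has been
    exhausted, since [W] does not return to itself within [size ks] steps. *)
Lemma tower_step (r : rel T) ks x : r m0 m0 -> path r m0 (rcons ks m0) ->
  (forall y i, W y -> (0 < i)%N -> (i <= size ks)%N -> ~ W (iter i alpha y)) ->
  r (tower ks x) (tower ks (alpha x)).
Proof.
move=> rm0; case: ks => [|k ks]//= /andP[m0k pk] disj.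
have [Wx|Wx] := pselect (W (alpha x)).
  rewrite (asboolT Wx).
  rewrite (_ : (if _ then _ else _) = m0)//.
  apply: (@tower_off (k :: ks)) => i ik Wi.
  by apply: (disj _ i.+1 Wi) => //=; rewrite iter_inv_homeo.
rewrite (asboolF Wx) homeo_funK.
elim: ks k x pk {m0k disj Wx} => [|k' ks IH] k x /= /andP[kk' pk].
  by case: ifP.
by case: ifP => // _; exact: IH.
Qed.

End tower.

Section skew_maps.
Context {R : realType} {K : topologicalType} {Z : compactMetricType R}.
Variable alpha : homeo K.
Implicit Types (g c : K -> homeo Z) (p : K * Z).

Definition skew_map c p := (alpha p.1, c p.1 p.2).

Definition coboundary g x : homeo Z := ((g (alpha x))^-1 * g x)%g.

Lemma iter_skew_fst c n p : (iter n (skew_map c) p).1 = iter n alpha p.1.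
Proof. by elim: n => //= n ->. Qed.

(** A coboundary telescopes along orbits: the skew product is conjugate to
    [alpha * id] by [(x, z) |-> (x, g x z)]. *)
Lemma iter_skew_coboundary g n p :
  iter n (skew_map (coboundary g)) p =
  (iter n alpha p.1, homeo_inv (g (iter n alpha p.1)) (g p.1 p.2)).
Proof.
elim: n => [|n IH]/=; first by rewrite homeo_funK -surjective_pairing.
by rewrite IH /skew_map /= homeo_invK.
Qed.

Lemma coboundary_locally_constant g :
  locally_constant g -> locally_constant (coboundary g).
Proof.
move=> lg; apply: (locally_constant2 (fun a b => (a^-1 * b)%g)) => //.
exact: (locally_constant_comp (@homeo_cts _ alpha)).
Qed.

(** [P] holds in a neighbourhood of [c] for uniform convergence; [c'] ranges
    over all maps, so that continuity need not be carried along. *)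
Definition near_cocycle c (P : (K -> homeo Z) -> Prop) :=
  \forall d \near 0^'+, forall c',
    (forall x, homeo_dist (c x) (c' x) <= d) -> P c'.

Lemma iter_skew_stable c n (e : R) : compact [set: K] -> locally_constant c ->
  0 < e -> near_cocycle c (fun c' => forall p,
    mdist (iter n (skew_map c) p).2 (iter n (skew_map c') p).2 < e).
Proof.
move=> cK lc; have [s sP] := locally_constant_range cK lc.
elim: n e => [|n IH] e e0; first by apply: nearW => d c' _ p /=; rewrite mdistxx.
have e20 : 0 < e / 2 by rewrite divr_gt0.
have : \forall r \near (0 : R)^'+, forall h, h \in s -> forall z w,
    mdist z w < r -> mdist (h z) (h w) < e / 2.
  by apply: near_all_seq => h _; apply: compact_unif_cont => //; exact: homeo_cts.
move=> /(filterI (nbhs_right_gt 0))/filter_ex[r [r0 rP]].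
have := IH r r0; rewrite /near_cocycle => IHr.
apply: filterS2 IHr (nbhs_right_lt e20) => d IHd de c' cc' p /=.
set q := iter n (skew_map c) p; set q' := iter n (skew_map c') p.
have qq' : q.1 = q'.1 by rewrite /q /q' !iter_skew_fst.
have := metric_triangle (c q.1 q.2) (c q.1 q'.2) (c' q'.1 q'.2).
have := rP _ (sP q.1) _ _ (IHd c' cc' p).
have := le_trans (homeo_dist_fun (c q.1) (c' q.1) q'.2) (cc' q.1).
by rewrite -/q -/q' -qq'; lra.
Qed.

End skew_maps.

(** * Perturbing a coboundary so that its orbits visit a given open set *)

Lemma clopen_all {T : topologicalType} {I : eqType} (s : seq I) (A : I -> set T) :
  (forall i, i \in s -> clopen (A i)) -> clopen [set x | forall i, i \in s -> A i x].
Proof.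
elim: s => [|a s IH] cA.
  by rewrite (_ : [set x | _] = setT); [exact: clopenT | apply/seteqP; split].
rewrite (_ : [set x | _] = A a `&` [set x | forall i, i \in s -> A i x]).
  apply: clopenI; first by apply: cA; rewrite mem_head.
  by apply: IH => i si; apply: cA; rewrite inE si orbT.
apply/seteqP; split=> x /=.
  by move=> Ax; split => [|i si]; apply: Ax; rewrite inE ?eqxx ?si ?orbT.
by move=> [Aax Ax] i; rewrite inE => /orP[/eqP ->|/Ax].
Qed.

Section perturbation.
Context {R : realType} {K : topologicalType} {Z : compactMetricType R}.
Variable alpha : homeo K.
Hypotheses (cK : compact [set: K]) (hK : hausdorff_space K).
Hypotheses (zK : zero_dimensional K) (iK : infinite_set [set: K]).
Hypothesis alpha_minimal : minimal_homeo alpha.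

(** Finitely many clopen conditions at [x0]: aperiodicity separates [x0] from
    its first iterates, and the visits of [x0] to [V] persist nearby. *)
Lemma tower_base (V : set K) x0 n : clopen V -> exists W : set K,
  [/\ clopen W, W x0,
      forall y i, W y -> (0 < i)%N -> (i <= n)%N -> ~ W (iter i alpha y) &
      forall i y, (i <= n)%N -> V (iter i alpha x0) -> W y -> V (iter i alpha y)].
Proof.
move=> clV.
have /choice[U UP] i : exists U : set K,
    (0 < i)%N -> [/\ clopen U, U x0 & ~ U (iter i alpha x0)].
  have [i0|] := ltnP 0 i; last by exists setT.
  have /zK[U UP] : x0 != iter i alpha x0.
    by apply/eqP => /esym; exact: minimal_aperiodic.
  by exists U.
(* the first factor keeps the visits to [V], the second forbids early returns *)
pose A i := (if `[< V (iter i alpha x0) >] then iter i alpha @^-1` V else setT) `&`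
  (if (0 < i)%N then U i `&` ~` (iter i alpha @^-1` U i) else setT).
exists [set x | forall i, i \in iota 0 n.+1 -> A i x]; split.
- apply: clopen_all => i _; apply: clopenI.
    case: ifP => _; last exact: clopenT.
    by apply: preimage_clopen => //; exact: iter_homeo_cts.
  case: ifPn => [i0|_]; last exact: clopenT.
  have [cU _ _] := UP i i0.
  apply: clopenI => //; apply: clopenC => //.
  by apply: preimage_clopen => //; exact: iter_homeo_cts.
- move=> i _; split; first by case: asboolP.
  by case: ifPn => // i0; have [_ U0 Ui] := UP i i0.
- move=> y i Wy i0 ij Wi.
  have := Wy i; rewrite mem_iota /= add0n ltnS ij => /(_ isT)[_].
  rewrite i0 => -[_]; apply.
  have := Wi i; rewrite mem_iota /= add0n ltnS ij => /(_ isT)[_].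
  by rewrite i0 => -[].
- move=> i y ij Vi /(_ i); rewrite mem_iota /= add0n ltnS ij => /(_ isT)[+ _].
  by rewrite asboolT.
Qed.

(** The key step: [h] is the tower function of a walk through finitely many
    elements of [M] whose images of the open set [g O] cover the fibre. *)
Lemma coboundary_perturbation (M : set (homeo Z)) m0 g (e : R) (V : set K)
    (O : set Z) :
  pathwise_connected R M -> acts_minimally M -> M m0 ->
  locally_constant g -> 0 < e -> clopen V -> V !=set0 -> open O -> O !=set0 ->
  exists h : K -> homeo Z, let g' x := (h x * g x)%g in
    [/\ locally_constant h, forall x, M (h x),
        forall x, homeo_dist (coboundary alpha g x) (coboundary alpha g' x) < e &
        \forall N \near \oo, forall p, exists2 n, (n <= N)%N &
          (V `*` O) (iter n (skew_map alpha (coboundary alpha g')) p)].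
Proof.
move=> pM [_ minM] Mm0 lg e0 clV [v Vv] oO [z0 Oz0].
have [s sP] := locally_constant_range cK lg.
have := homeo_dist_insert (s ++ map (fun f : homeo Z => f^-1)%g s) e0.
move=> /(filterI (nbhs_right_gt 0))/filter_ex[d [d0 dP]].
have d20 : 0 < d / 2 by rewrite divr_gt0.
(* on [V'] the open set to be reached is the same in every fibre *)
pose V' := V `&` [set x | g x = g v].
have clV' : clopen V' by apply: clopenI => //; exact: locally_constant_clopen.
have V'v : V' v by [].
have [hs hsM hsO] : exists2 hs : seq (homeo Z), [set` hs] `<=` M &
    \bigcup_(h in [set` hs]) (h @` (homeo_inv (g v) @^-1` O)) = [set: Z].
  apply: minM; last by exists (g v z0); rewrite /= homeo_funK.
  by apply: open_comp => // z _; exact: homeo_inv_cts.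
have [oV' _] := clV'.
have rec := minimal_recurrent v cK alpha_minimal oV' (ex_intro _ v V'v).
have [ks [ksM ksp ksv]] := walk d20 pM Mm0 rec hsM.
have [W [clW Wv Wdisj WV]] := tower_base v (size ks) clV'.
pose h := tower alpha m0 W ks.
have lh : locally_constant h by exact: tower_locally_constant.
exists h; split => //.
- by move=> x; exact: tower_in.
- move=> x.
  pose k := ((h (alpha x))^-1 * h x)%g.
  rewrite homeo_dist_sym.
  rewrite (_ : coboundary alpha (fun x => (h x * g x)%g) x =
    ((g (alpha x))^-1 * k * g x)%g); last exact: homeo_eq.
  apply: dP.
  + by rewrite mem_cat map_f ?orbT.
  + by rewrite mem_cat sP.
  apply: le_lt_trans (homeo_dist_divl _ _) _.
  have : near_step (d / 2) (h x) (h (alpha x)).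
    by apply: tower_step => //; rewrite /near_step mdistxx.
  by rewrite /near_step metric_sym /mdist /=; lra.
- have : \forall N \near \oo, forall k, k \in hs -> forall y,
      exists2 n, (n <= N)%N & (V' `&` [set x | h x = k]) (iter n alpha y).
    apply: near_all_seq => k khs.
    apply: minimal_hitting => //.
      by apply: openI => //; have [] := locally_constant_clopen k lh.
    have [j [jks kj Vj]] := ksv k khs.
    exists (iter j alpha v); split => //=.
    rewrite -kj; apply: tower_level => // i i0 ij.
    by apply: Wdisj => //; apply: leq_trans ij (ltnW jks).
  apply: filterS => N NP [x z].
  have : [set: Z] (h x (g x z)) by [].
  rewrite -hsO => -[k /= khs [w /= Ow kw]].
  have [n nN [[Vn gn] hn]] := NP k khs x.
  exists n => //; rewrite iter_skew_coboundary; split => //=.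
  by rewrite hn gn -kw homeo_funK.
Qed.

End perturbation.

(** * Limits of coboundaries with generic properties *)

Section closed_subgroups.
Context {R : realType} {Z : compactMetricType R}.
Variable G : set (homeo Z).
Hypothesis sG : closed_subgroup G.

Lemma closed_subgroupV f : G f -> G (f^-1)%g.
Proof. by have [_ G1 GB] := sG => Gf; rewrite -[(f^-1)%g]mul1g; exact: GB. Qed.

Lemma closed_subgroupM f g : G f -> G g -> G (f * g)%g.
Proof.
have [_ _ GB] := sG => Gf Gg; rewrite -[g]invgK.
by apply: GB => //; exact: closed_subgroupV.
Qed.

End closed_subgroups.

Section generic_cocycle.
Context {R : realType} {K : topologicalType} {Z : compactMetricType R}.
Variables (alpha : homeo K) (G : set (homeo Z)).
Hypothesis sG : closed_subgroup G.
Implicit Types (g c : K -> homeo Z) (P : (K -> homeo Z) -> Prop).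

(** Among the coboundaries of locally constant [G]-valued functions, [P] holds
    on an open dense set. *)
Definition generic_property P := forall g (e : R),
  locally_constant g -> (forall x, G (g x)) -> 0 < e ->
  exists g', [/\ locally_constant g', forall x, G (g' x),
    forall x, homeo_dist (coboundary alpha g x) (coboundary alpha g' x) < e &
    near_cocycle (coboundary alpha g') P].

(** The proof of the Baire category theorem: the state is a function [g] with
    a radius [r], and the next radius is at most half of it.  The telescoping
    bound [r_ n - r_ m] keeps the limit within [r_ n] up to a factor 2. *)
Lemma generic_cocycle_seq (P : nat -> (K -> homeo Z) -> Prop) :
  (forall n, generic_property (P n)) ->
  exists c, [/\ continuous c, forall x, G (c x) & forall n, P n c].
Proof.
move=> gP.
pose ok (s : (K -> homeo Z) * R) :=
  [/\ locally_constant s.1, forall x, G (s.1 x) & 0 < s.2].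
pose step (n : nat) (s t : (K -> homeo Z) * R) :=
  [/\ forall x, homeo_dist (coboundary alpha s.1 x) (coboundary alpha t.1 x) <= s.2 / 2,
      t.2 <= s.2 / 2, t.2 <= n.+1%:R^-1 &
      forall c, (forall x, homeo_dist (coboundary alpha t.1 x) (c x) <= t.2 + t.2) ->
        P n c].
have /choice[next nextP] (ns : nat * ((K -> homeo Z) * R)) :
    exists t, ok ns.2 -> ok t /\ step ns.1 ns.2 t.
  case: ns => n [g r] /=; have [[/= lg Gg r0]|] := pselect (ok (g, r)); last first.
    by exists (g, r).
  have r20 : 0 < r / 2 by rewrite divr_gt0.
  have [g' [lg' Gg' gg' gP']] := gP n g (r / 2) lg Gg r20.
  have := gP'; rewrite /near_cocycle => gP''.
  have [d [d0 dP]] := filter_ex (filterI (nbhs_right_gt 0) gP'').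
  have n0 : 0 < n.+1%:R^-1 :> R by rewrite invr_gt0.
  pose t := Num.min (d / 2) (Num.min (r / 2) n.+1%:R^-1).
  have [td tr tn] : [/\ t <= d / 2, t <= r / 2 & t <= n.+1%:R^-1].
    by split; rewrite /t !ge_min lexx ?orbT.
  have t0 : 0 < t by rewrite /t !lt_min n0 r20 divr_gt0.
  exists (g', t) => _; split; split => //=.
    by move=> x; exact: ltW.
  move=> c gc; apply: dP => x; apply: le_trans (gc x) _; lra.
have [_ G1 _] := sG.
pose fix state n := if n is n'.+1 then next (n', state n') else
  (fun=> 1%g : homeo Z, 1 : R).
have ok_state n : ok (state n).
  elim: n => [|n IH]; last by have [] := nextP (n, state n) IH.
  by split => //= x; exact: nearW.
have step_state n : step n (state n) (state n.+1).
  by have [] := nextP (n, state n) (ok_state n).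
pose c_ n := coboundary alpha (state n).1.
pose r_ n := (state n).2.
have r_gt0 n : 0 < r_ n by have [] := ok_state n.
have cauchy_r n m x : (n <= m)%N -> homeo_dist (c_ n x) (c_ m x) <= r_ n - r_ m.
  move=> /subnK<-; elim: (m - n)%N => [|k IH].
    by rewrite add0n homeo_distxx subrr.
  rewrite addSn; have [/(_ x) cr rr _ _] := step_state (k + n)%N.
  have := homeo_dist_triangle (c_ (k + n)%N x) (c_ n x) (c_ (k + n).+1 x).
  by rewrite /c_ /r_ in IH cr rr *; lra.
have r_small e : 0 < e -> exists n, r_ n < e.
  move=> e0; have /filter_ex[n ne] := near_infty_natSinv_lt (PosNum e0).
  by exists n.+1; have [_ _ rn _] := step_state n; exact: le_lt_trans rn ne.
have /choice[c cP] x : exists f : homeo Z,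
    forall n, homeo_dist (c_ n x) f <= r_ n + r_ n.
  apply: (homeo_complete (u := fun n => c_ n x)) => // n m nm.
  by apply: le_trans (cauchy_r n m x nm) _; rewrite gerBl ltW.
exists c; split.
- move=> x; apply/metricType_numDomainType.cvgrPdist_lt => e e0.
  have e40 : 0 < e / 4 by rewrite divr_gt0.
  have [n re] := r_small _ e40.
  have [lg _ _] := ok_state n.
  apply: filterS (coboundary_locally_constant alpha lg x) => y cyx.
  have := homeo_dist_triangle (c_ n x) (c x) (c y).
  have := cP x n; have := cP y n.
  rewrite /c_ cyx (homeo_dist_sym (c x) (coboundary _ _ _)) => cy cx cxy.
  have : homeo_dist (c x) (c y) < e by lra.
  by [].
- move=> x; have [cG _ _] := sG; apply: closed_homeo_dist cG _ => e e0.
  have e20 : 0 < e / 2 by rewrite divr_gt0.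
  have [n re] := r_small _ e20.
  exists (c_ n x); last by rewrite homeo_dist_sym; have := cP x n; lra.
  have [_ Gg _] := ok_state n.
  apply: (closed_subgroupM sG) => //; exact: closed_subgroupV.
- move=> n; have [_ _ _ Pn] := step_state n.
  by apply: Pn => x; exact: (cP x n.+1).
Qed.

Lemma generic_cocycle (I : countType) (P : I -> (K -> homeo Z) -> Prop) :
  (forall i, generic_property (P i)) ->
  exists c, [/\ continuous c, forall x, G (c x) & forall i, P i c].
Proof.
move=> gP.
pose Q n c := if unpickle n is Some i then P i c else True.
have [n|c [cc Gc Qc]] := generic_cocycle_seq (P := Q).
  rewrite /Q; case: (unpickle n) => [i|]; first exact: gP.
  move=> g e lg Gg e0; exists g; split => //; last exact: nearW.
  by move=> x; rewrite homeo_distxx.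
by exists c; split => // i; have := Qc (pickle i); rewrite /Q pickleK.
Qed.

End generic_cocycle.

Section generic_properties.
Context {R : realType} {K : topologicalType} {Z : compactMetricType R}.
Variables (alpha : homeo K) (G : set (homeo Z)).
Hypotheses (cK : compact [set: K]) (hK : hausdorff_space K).
Hypotheses (zK : zero_dimensional K) (iK : infinite_set [set: K]).
Hypothesis alpha_minimal : minimal_homeo alpha.
Hypothesis sG : closed_subgroup G.

(** Halving the radius gives room for the stability of the visit. *)
Lemma generic_visit (M : set (homeo Z)) m0 (V : set K) (z : Z) (r : R) :
  M `<=` G -> pathwise_connected R M -> acts_minimally M -> M m0 ->
  clopen V -> V !=set0 -> 0 < r ->
  generic_property alpha G (fun c => forall p, exists n,
    V (iter n (skew_map alpha c) p).1 /\
    mdist z (iter n (skew_map alpha c) p).2 < r).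
Proof.
move=> MG pM minM Mm0 clV V0 r0 g e lg Gg e0.
have r20 : 0 < r / 2 by rewrite divr_gt0.
have [||h] := coboundary_perturbation (V := V) (O := (ball z (r / 2))°) cK hK zK iK
  alpha_minimal pM minM Mm0 lg e0 clV V0.
- exact: open_interior.
- by exists z; exact: nbhsx_ballx.
set g' := fun x => (h x * g x)%g.
move=> [lh Mh gg' /filter_ex[N NP]]; exists g'.
have lg' : locally_constant g' by exact: (locally_constant2 (fun a b => (a * b)%g)).
split => //.
  by move=> x; apply: (closed_subgroupM sG) => //; exact: MG.
have lc' := coboundary_locally_constant alpha lg'.
have : \forall d \near 0^'+, forall n, n \in iota 0 N.+1 -> forall c',
    (forall x, homeo_dist (coboundary alpha g' x) (c' x) <= d) -> forall p,
    mdist (iter n (skew_map alpha (coboundary alpha g')) p).2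
          (iter n (skew_map alpha c') p).2 < r / 2.
  by apply: near_all_seq => n _; exact: iter_skew_stable.
rewrite /near_cocycle; apply: filterS => d dP c c'c p.
have [n nN [Vn]] := NP p; move=> /interior_subset; rewrite ballEmdist /= => zn.
exists n; split; first by move: Vn; rewrite !iter_skew_fst.
have := dP n; rewrite mem_iota /= add0n ltnS nN => /(_ isT c c'c p).
have := metric_triangle z (iter n (skew_map alpha (coboundary alpha g')) p).2
  (iter n (skew_map alpha c) p).2.
by lra.
Qed.

(** The function [(x, z) |-> g x z] is continuous, invariant and not
    constant. *)
Lemma coboundary_not_minimal g (d : continuousType K (homeo Z)) (z1 z2 : Z) (x : K) :
  z1 <> z2 -> locally_constant g -> d =1 coboundary alpha g ->
  ~ minimal_homeo (skew_product alpha d).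
Proof.
move=> z12 lg dg min_d; set T := skew_product alpha d.
pose inv (p : K * Z) := g p.1 p.2.
have inv_step p : inv (T p) = inv p.
  by rewrite /inv /= dg /= homeo_invK.
have inv_iter n p : inv (iter n T p) = inv p.
  by elim: n => // n IH; rewrite iterS inv_step.
pose p1 := (x, homeo_inv (g x) z1); pose p2 := (x, homeo_inv (g x) z2).
pose O := [set y | g y = g x] `*` (g x @^-1` (~` [set z1])).
have oO : open O.
  have oz : open (g x @^-1` (~` [set z1])).
    apply: open_comp => [z _|]; first exact: homeo_cts.
    exact/closed_openC/accessible_closed_set1/hausdorff_accessible/metric_hausdorff.
  rewrite openE => -[y w] /= [gy zw].
  exists ([set y | g y = g x], g x @^-1` (~` [set z1])) => //=; split.
    by have := lg y; rewrite gy.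
  exact: open_nbhs_nbhs.
have O2 : O p2 by split => //=; rewrite homeo_invK; exact: nesym.
have [q [[gq zq] [n Hn]]] := min_d p1 O (ex_intro _ p2 O2) oO.
have : inv q = inv p1.
  case: Hn => ->; first by rewrite homeo_expgE inv_iter.
  by rewrite -(inv_iter n) -homeo_expgE; congr inv; exact: homeo_invK.
rewrite /inv gq /= homeo_invK.
exact: zq.
Qed.

(** A coboundary already differs from [d] at some point, and at that point so
    does every cocycle close to the coboundary. *)
Lemma generic_avoid (d : continuousType K (homeo Z)) (z1 z2 : Z) (x : K) :
  z1 <> z2 -> minimal_homeo (skew_product alpha d) ->
  generic_property alpha G (fun c => ~ c =1 d).
Proof.
move=> z12 min_d g e lg Gg e0; exists g; split => //.
  by move=> y; rewrite homeo_distxx.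
have [y /eqP ny] : exists y, coboundary alpha g y <> d y.
  apply/existsNP => dg; apply: (coboundary_not_minimal x z12 lg _ min_d) => y.
  exact: esym.
have dy0 : 0 < homeo_dist (coboundary alpha g y) (d y).
  by have := mdist_gt0 (coboundary alpha g y) (d y); rewrite ny.
apply: filterS (nbhs_right_lt dy0) => r dr c gc cd.
by have := gc y; rewrite cd leNgt dr.
Qed.

End generic_properties.

(** * The Cantor space *)

Definition cylinder (s : seq bool) : set cantor_space :=
  [set x | forall i, (i < size s)%N -> x i = nth false s i].

Lemma coordinate_clopen i b : clopen [set x : cantor_space | x i = b].
Proof.
apply: (@preimage_clopen cantor_space bool (fun x => x i) [set b]).
  by split; [exact: discrete_open | exact: discrete_closed].
exact: (@proj_continuous nat (fun=> bool) i).
Qed.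

Lemma cylinder_clopen s : clopen (cylinder s).
Proof.
rewrite (_ : cylinder s = [set x | forall i, i \in iota 0 (size s) ->
    [set x : cantor_space | x i = nth false s i] x]).
  by apply: clopen_all => i _; exact: coordinate_clopen.
apply/seteqP; split=> x xs i; first by rewrite mem_iota; exact: xs.
by move=> i_s; apply: xs; rewrite mem_iota.
Qed.

Lemma cylinder_neq0 s : cylinder s !=set0.
Proof. by exists (fun i => nth false s i). Qed.

(** The cylinders around [x] have [x] as their only cluster point, so they
    converge to [x] by compactness. *)
Lemma cylinder_nbhs (x : cantor_space) (U : set cantor_space) : nbhs x U ->
  exists2 s, cylinder s x & cylinder s `<=` U.
Proof.
pose A n := cylinder (mkseq x n).
have Ax n : A n x by move=> i; rewrite size_mkseq => i_n; rewrite nth_mkseq.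
have FF : ProperFilter (filter_from setT A).
  apply: filter_from_proper; last by move=> n _; exists x.
  apply: filter_from_filter; first by exists 0%N.
  move=> n m _ _; exists (maxn n m) => // y yA.
  split=> i; rewrite size_mkseq => i_n; rewrite nth_mkseq//.
    by rewrite yA ?size_mkseq ?nth_mkseq// leq_max i_n.
  by rewrite yA ?size_mkseq ?nth_mkseq// leq_max i_n orbT.
have Fx : cluster (filter_from setT A) = [set x].
  apply/seteqP; split=> y /=; last first.
    by move=> -> B C [n _ nB] /nbhs_singleton Cx; exists x; split => //; exact: nB.
  move=> cly; apply: funext => i.
  have [oi _] := coordinate_clopen i (y i).
  have yi : nbhs y [set x : cantor_space | x i = y i] by exact: open_nbhs_nbhs.
  have FA : filter_from setT A (A i.+1) by exists i.+1.
  have [z [zA /= <-]] := cly _ _ FA yi.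
  by rewrite zA ?size_mkseq// nth_mkseq.
move=> Ux.
have [n _ nU] := compact_cluster_set1 cantor_space_hausdorff cantor_space_compact
  filterT FF filterT Fx Ux.
by exists (mkseq x n); [exact: Ax | exact: nU].
Qed.

Lemma cantor_space_infinite : infinite_set [set: cantor_space].
Proof.
move=> fK; pose f n : cantor_space := fun i => i == n.
apply: infinite_nat; rewrite -(preimage_setT f).
apply: finite_preimage fK => n m _ _ fnm.
by have := congr1 (fun x : cantor_space => x n) fnm; rewrite /f eqxx => /esym/eqP.
Qed.

(** * Uncountably many minimal skew products *)

Section existence.
Context {R : realType} {Z : compactMetricType R}.

Lemma lip_group_closed_subgroup (L : R) : closed_subgroup (@lip_group R Z L).
Proof.
split.
- by apply: closed_bigI => A [[cA _ _] _].
- by move=> A [[_ A1 _] _].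
- by move=> f g Gf Gg A AL; have [[_ _ AB] _] := AL; apply: AB; [exact: Gf | exact: Gg].
Qed.

Lemma infinite_two_points {T : Type} : infinite_set [set: T] ->
  exists z1 z2 : T, z1 <> z2.
Proof.
move=> iT; apply: contrapT => ne; apply: iT.
have [[z _]|/set0P/negP/negPn/eqP ->//] := pselect ([set: T] !=set0).
apply: (@sub_finite_set _ _ [set z]) => // y _ /=.
by apply: contrapT => yz; apply: ne; exists y, z.
Qed.

Lemma minimal_skew_product (alpha : homeo cantor_space)
    (c : continuousType cantor_space (homeo Z)) (net : nat -> seq Z) (z0 : Z) :
  (forall n z, exists2 w, w \in net n & mdist w z < n.+1%:R^-1) ->
  (forall s k j p, exists n, cylinder s (iter n (skew_map alpha c) p).1 /\
    mdist (nth z0 (net k) j) (iter n (skew_map alpha c) p).2 < k.+1%:R^-1) ->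
  minimal_homeo (skew_product alpha c).
Proof.
move=> netP visit p O [[x z] Oxz] oO.
have [[A B] /= [xA zB] AB] := open_nbhs_nbhs (conj oO Oxz).
have [s _ sA] := cylinder_nbhs xA.
have /nbhs_ballP[r /= r0] := zB; rewrite ballEmdist => rB.
have r20 : 0 < r / 2 by rewrite divr_gt0.
have /filter_ex[k kr] := near_infty_natSinv_lt (PosNum r20).
have {}kr : k.+1%:R^-1 < r / 2 := kr.
have [w /(nthP z0)[j jk jw] wz] := netP k z.
have [n [sn wn]] := visit s k j p.
exists (iter n (skew_map alpha c) p); split.
  apply: AB; split; first exact: sA.
  rewrite jw in wn; apply: rB => /=.
  have := metric_triangle z w (iter n (skew_map alpha c) p).2.
  have wz' := lt_trans wz kr; have wn' := lt_trans wn kr; move: wz' wn'.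
  by rewrite (metric_sym z w) {wz wn kr}; lra.
by exists n; left; rewrite homeo_expgE.
Qed.

End existence.

Unset Implicit Arguments.

Theorem theorem4p5 (R : realType) (Omega : compactMetricType R)
  (Omega_infinite : infinite_set [set: Omega])
  (Omega_CW : inhabited (finite_CW R Omega))
  (Omega_connected : connected [set: Omega])
  (Omega_LMP : lipschitz_minimal_property Omega)
  (alpha : homeo cantor_space) (alpha_minimal : minimal_homeo alpha) :
  exists L : R, 0 < L /\
    ~ countable [set c : continuousType cantor_space (homeo Omega) |
                  (forall x, lip_group L (c x)) /\
                  minimal_homeo (skew_product alpha c)].
Proof.
have [L [L0 [M [ML pM minM]]]] := Omega_LMP.
exists L; split => //; set S := [set c | _] => /countable_injP[f finj].
have [z1 [z2 z12]] := infinite_two_points Omega_infinite.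
have [m0 Mm0] : M !=set0.
  have [hs hsM hsT] := minM.2 setT openT (ex_intro _ z1 I).
  have [h hhs _] : (\bigcup_(h in [set` hs]) (h @` [set: Omega])) z1.
    by rewrite hsT.
  by exists h; exact: hsM.
have sG := @lip_group_closed_subgroup R Omega L.
have MG : M `<=` lip_group L by move=> h /ML hL A [_]; exact.
have /choice[net netP] n : exists s : seq Omega,
    forall z, exists2 w, w \in s & mdist w z < n.+1%:R^-1.
  by apply: finite_net; rewrite invr_gt0.
(* [inl] properties give dense orbits; [inr m] excludes the cocycle that the
   assumed injection [f] numbers [m] *)
pose P (i : (seq bool * (nat * nat)) + nat) (c : cantor_space -> homeo Omega) :=
  match i with
  | inl (s, (k, j)) => forall p, exists n,
      cylinder s (iter n (skew_map alpha c) p).1 /\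
      mdist (nth z1 (net k) j) (iter n (skew_map alpha c) p).2 < k.+1%:R^-1
  | inr m => forall d, S d -> f d = m -> ~ c =1 d
  end.
have [i|c [cc Gc Pc]] := generic_cocycle (alpha := alpha) sG (P := P).
  case: i => [[s [k j]]|m].
    apply: (generic_visit cantor_space_compact cantor_space_hausdorff
      cantor_zero_dimensional cantor_space_infinite alpha_minimal sG _
      MG pM minM Mm0) => //.
    - exact: cylinder_clopen.
    - exact: cylinder_neq0.
  have [[d [Sd fd]]|nd] := pselect (exists d, S d /\ f d = m); last first.
    move=> g e lg Gg e0; exists g; split => //.
      by move=> x; rewrite homeo_distxx.
    by apply: nearW => r c _ d Sd fd; case: nd; exists d.
  have -> : P (inr m) = (fun c => ~ c =1 d).
    apply/funext => c; apply/propext; split; first by apply.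
    move=> cd d' Sd' fd'; have -> // : d' = d.
    by apply: finj; rewrite ?inE// fd.
  exact: (@generic_avoid R cantor_space Omega alpha _ d z1 z2 (fun=> false) z12 Sd.2).
pose c' : continuousType cantor_space (homeo Omega) := mkcts cc.
have Sc' : S c'.
  split; first exact: Gc.
  apply: (minimal_skew_product netP) => s k j.
  exact: (Pc (inl (s, (k, j)))).
exact: (Pc (inr (f c')) c' Sc' erefl).
Qed.
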